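(* Let $X$ be a real Banach space and let $A\colon X\rightrightarrows X^*$ be maximally monotone with $\operatorname{int}\operatorname{dom}A\neq\varnothing$. Let $S\subseteq\operatorname{int}\operatorname{dom}A$ be dense in $\operatorname{int}\operatorname{dom}A$. Then for every $x\in X$, $$Ax=N_{\overline{\operatorname{dom}A}}(x)+\overline{\operatorname{conv}\left[A_S(x)\right]}^{w*}=\operatorname{rec}A(x)+\overline{\operatorname{conv}\left[A_S(x)\right]}^{w*}.$$
   Context: $X$ is a real Banach space with norm $\|\cdot\|$, continuous dual $X^*$ and pairing $\langle\cdot,\cdot\rangle$. A set-valued operator $A\colon X\rightrightarrows X^*$ assigns to each $x\in X$ a (possibly empty) set $Ax\subseteq X^*$; its graph is $\operatorname{gra}A=\{(x,x^* )\mid x^*\in Ax\}$ and its domain is $\operatorname{dom}A=\{x\mid Ax\neq\varnothing\}$. $A$ is monotone if $\langle x-y,x^*-y^*\rangle\ge 0$ for all $(x,x^* ),(y,y^* )\in\operatorname{gra}A$, and maximally monotone if it is monotone and has no proper monotone extension (in the sense of graph inclusion). $\operatorname{int}$ and $\overline{C}$ denote norm interior and norm closure in $X$; $\overline{D}^{w*}$ is the weak$^*$ closure of $D\subseteq X^*$; $\operatorname{conv}$ is the convex hull. For $C\subseteq X$, the normal cone is $N_C(x)=\{x^*\in X^*\mid \sup_{c\in C}\langle c-x,x^*\rangle\le 0\}$ if $x\in C$, and $N_C(x)=\varnothing$ if $x\notin C$. For $S\subseteq\operatorname{dom}A$, the operator $A_S\colon X\rightrightarrows X^*$ is defined by letting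 $\operatorname{gra}A_S$ be the norm $\times$ weak$^*$ closure of $\operatorname{gra}A\cap(S\times X^* )$; that is, $x^*\in A_S(x)$ iff there is a net $(x_\alpha,x_\alpha^* )$ in $\operatorname{gra}A$ with $x_\alpha\in S$, $x_\alpha\to x$ in norm and $x^*_\alpha\to x^*$ weak$^*$. For $x\in X$, $\operatorname{rec}A(x)$ is the set of $x^*\in X^*$ for which there exist sequences $t_n\to 0^+$ (positive reals) and $(a_n,a_n^* )\in\operatorname{gra}A$ with $a_n\to x$ in norm and $t_na_n^*\to x^*$ weak$^*$. Sums of sets are Minkowski sums, and the sum of any set with the empty set is empty. *)

(* Defs.v *)
From HB Require Import structures.
From mathcomp Require Import all_boot all_order all_algebra.
From mathcomp Require Import all_classical all_reals all_analysis.

Set Implicit Arguments.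
Unset Strict Implicit.
Unset Printing Implicit Defensive.

Import Order.TTheory GRing.Theory Num.Theory.
Import numFieldNormedType.Exports.

Local Open Scope classical_set_scope.
Local Open Scope ring_scope.

Section dual.
Context {R : realType} (X : normedModType R).

Definition continuous_linear : {pred X -> R^o} :=
  [pred f : X -> R^o | `[< linear f /\ continuous f >]].

Lemma continuous_linearP (f : X -> R^o) :
  reflect (linear f /\ continuous f) (f \in continuous_linear).
Proof. exact: asboolP. Qed.

Fact continuous_linear_submod_closed : submod_closed continuous_linear.
Proof.
split.
  apply/continuous_linearP; split; last exact: cst_continuous.
  by move=> a u v; rewrite -[RHS]/(a *: (0 : R^o) + 0) scaler0 addr0.
move=> a f g /continuous_linearP[fl fc] /continuous_linearP[gl gc].
apply/continuous_linearP; split=> [b u v|x].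
  rewrite -[LHS]/(a *: f (b *: u + v) + g (b *: u + v)).
  rewrite -[RHS]/(b *: (a *: f u + g u) + (a *: f v + g v)).
  by rewrite fl gl !scalerDr !scalerA (mulrC a b) addrACA.
apply: (@continuousD R R^o X (fun y => a *: f y) g x); last exact: gc.
by apply: cvgZl_tmp; exact: fc.
Qed.

HB.instance Definition _ := GRing.isSubmodClosed.Build R (X -> R^o)
  continuous_linear continuous_linear_submod_closed.

Record dual := Dual {
  dual_val :> X -> R^o ;
  dual_valP : dual_val \in continuous_linear }.

HB.instance Definition _ := [isSub for dual_val].
HB.instance Definition _ := [Choice of dual by <:].
HB.instance Definition _ := [SubChoice_isSubLmodule of dual by <:].

(* [dual X] carries the weak* topology (never the norm topology): it is the
   topology induced by pointwise convergence of functions. *)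
HB.instance Definition _ :=
  Uniform.copy dual (initial_topology (dual_val : dual -> {ptws X -> R^o})).

Lemma dual_cvgP (F : set_system dual) (f : dual) : Filter F ->
  F --> f <-> forall x, g x @[g --> F] --> f x.
Proof.
move=> FF; have dcont := @initial_continuous dual {ptws X -> R^o} dual_val.
split=> [Ff|Ff A [B [[V oV <-] Vf] VA]].
  have : dual_val @ F --> (dual_val f : {ptws X -> R^o}).
    by apply: cvg_trans (dcont f); exact: cvg_app.
  by move/pointwise_cvgP.
apply: filterS VA _.
have /pointwise_cvgP : forall x, g x @[g --> dual_val @ F] --> f x := Ff.
by apply; exact: open_nbhs_nbhs.
Qed.

End dual.

Section operators.
Context {R : realType} {X : normedModType R}.
Implicit Types (A B : X -> set (dual X)) (C S : set X) (D E : set (dual X)).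

Definition gra A : set (X * dual X) := [set p | A p.1 p.2].

Definition dom A : set X := [set x | A x !=set0].

Definition monotone_operator A := forall p q, gra A p -> gra A q ->
  0 <= (p.2 - q.2) (p.1 - q.1).

Definition maximally_monotone A := monotone_operator A /\
  forall B, monotone_operator B -> gra A `<=` gra B -> gra B = gra A.

Definition normal_cone C (x : X) : set (dual X) :=
  [set f : dual X | C x /\ (ereal_sup [set (f (c - x))%:E | c in C] <= 0)%E].

(* The closure is taken in the product of the norm topology of [X] and the
   weak* topology of [dual X]. *)
Definition closure_along A S (x : X) : set (dual X) :=
  [set f : dual X | closure (gra A `&` (S `*` setT)) (x, f)].

Definition recession A (x : X) : set (dual X) :=
  [set f : dual X | exists (t : nat -> R) (a : nat -> X) (b : nat -> dual X),
    [/\ forall n, 0 < t n, t @ \oo --> 0, forall n, gra A (a n, b n),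
        a @ \oo --> x & (fun n => t n *: b n) @ \oo --> f]].

Definition convex_hull D : set (dual X) := smallest (@convex_set R (dual X)) D.

Definition minkowski_sum D E : set (dual X) :=
  [set f + g | f in D & g in E].

End operators.

(* Main.v *)
Require Import Defs.
From HB Require Import structures.
From mathcomp Require Import all_boot all_order all_algebra.
From mathcomp Require Import all_classical all_reals all_analysis.
From mathcomp Require Import ring lra.
Import Order.TTheory GRing.Theory Num.Theory.
Import numFieldNormedType.Exports.
Local Open Scope classical_set_scope.
Local Open Scope ring_scope.

Set Implicit Arguments.
Unset Strict Implicit.
Unset Printing Implicit Defensive.

(** Write D for the interior of dom A, x* for an element of A x, and K for the
weak* closed convex hull of A_S(x).

The inclusions from right to left rest on the norm x weak* closedness of the
graph of A. A net in the graph need not be bounded, so a pairing [⟨a, a*⟩]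
need not pass to the limit; but Baire's theorem makes A bounded around a point
of D, and monotonicity against that ball gives, for fixed z in D,
[eps * |a*| <= ⟨a - z, a*⟩ + const], which tames the nets
(lemma [limit_related]). Hence A_S(x), and with it K, lies in A x; the same
estimate applied to [t_n a_n*] puts rec A(x) inside the normal cone. A x is
stable under translation by normal vectors, and when A x is nonempty, every
normal vector h is the limit of [(x* + n h) / n], so it belongs to rec A(x).

For the converse, call v inward at x when [x + t v] lies in D for some t > 0.
- The inward vectors form an open convex cone, because dom A is star-shaped
  with respect to each point of D ([dom_segment]). This is where maximality
  must produce points of the domain: a Hahn-Banach argument does it.
- For v inward, A_S(x) has an element k with [⟨v, x*⟩ <= ⟨v, k⟩]
  ([closure_along_dominates]): choose points y of S approaching x along v;
  monotonicity between y and x gives the inequality, monotonicity between y and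
  a ball around [x + v] bounds A y, and Banach-Alaoglu yields a cluster point.
- So x* is, on inward vectors, below the support function of A_S(x). By the
  sandwich form of Hahn-Banach there is a continuous linear k that is above x*
  on inward vectors and below that support function everywhere. The latter
  means that k is in K, by weak* separation; the former means that x* - k is
  normal to dom A at x ([subgradient_decomposition]).

The three uses of Hahn-Banach (domain, weak* separation, sandwich) all go
through one statement about convex cones of linear inequalities,
[hahn_banach_cone]. *)

(** * Hahn-Banach for a cone of linear inequalities *)

Section HahnBanach.
Context {R : realType} {V : lmodType R}.
Implicit Types (P Q : set (V * R)) (v : V).

(** A pair (v, c) stands for the constraint [l v <= c] on an unknown linear
functional l. Constraints that follow from others by addition and nonnegative
scaling are kept in the set; consistency then only has to be tested at v = 0. *)
Definition cone_constraints P :=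
  [/\ forall p q, P p -> P q -> P (p.1 + q.1, p.2 + q.2),
      forall (t : R) p, 0 <= t -> P p -> P (t *: p.1, t * p.2) &
      forall c, P (0, c) -> 0 <= c].

Lemma maximal_cone_constraints P : cone_constraints P ->
  exists2 Q, P `<=` Q /\ cone_constraints Q &
    forall Q', Q `<=` Q' -> cone_constraints Q' -> Q' `<=` Q.
Proof.
move=> cP.
have [F FP totF|Q [cQ maxQ]] := @Zorn_bigcup _ [set Q | cone_constraints (P `|` Q)].
  have common p q : (P `|` \bigcup_(X in F) X) p -> (P `|` \bigcup_(X in F) X) q ->
      exists2 Y, cone_constraints Y /\ Y `<=` P `|` \bigcup_(X in F) X & Y p /\ Y q.
    have sub X : F X -> P `|` X `<=` P `|` \bigcup_(X in F) X.
      by move=> FX r [Pr|Xr]; [left|right; exists X].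
    move=> [Pp|[X FX Xp]] [Pq|[Y FY Yq]].
    - by exists P => //; split=> // r; left.
    - by exists (P `|` Y); [split; [exact: FP|exact: sub]|split; [left|right]].
    - by exists (P `|` X); [split; [exact: FP|exact: sub]|split; [right|left]].
    - have [XY|YX] := totF _ _ FX FY.
      + exists (P `|` Y); [split; [exact: FP|exact: sub]|].
        by split; right => //; exact: XY.
      + exists (P `|` X); [split; [exact: FP|exact: sub]|].
        by split; right => //; exact: YX.
  split.
  - move=> p q /common/[apply] -[Y [[addY _ _] YF] [Yp Yq]].
    by apply: YF; exact: addY.
  - move=> t p t0 Pp; have [Y [[_ scY _] YF] [Yp _]] := common _ _ Pp Pp.
    by apply: YF; exact: scY.
  - by move=> c Pc; have [Y [[_ _ Y0] _] [Yc _]] := common _ _ Pc Pc; exact: Y0.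
exists (P `|` Q); first by split=> // p; left.
move=> Q' QQ' cQ' p Q'p; apply: contrapT => nQp.
apply: (maxQ Q'); last by rewrite /= setUidr// => r Pr; apply: QQ'; left.
split; first by move=> r Qr; apply: QQ'; right.
by move=> /(_ p Q'p) Qp; apply: nQp; right.
Qed.

(** In a maximal consistent cone every vector v has a tight constraint: with
[a] the infimum of the c such that (v, c) is in the cone, adding the whole line
spanned by (v, a) keeps consistency. The tight values then are the functional. *)
Theorem hahn_banach_cone P : cone_constraints P ->
    (forall v, exists c, P (v, c)) ->
  exists l : V -> R^o, linear l /\ forall v c, P (v, c) -> l v <= c.
Proof.
move=> cP totP; have [Q [PQ [addQ scQ Q0]] maxQ] := maximal_cone_constraints cP.
have totQ v : exists c, Q (v, c) by have [c /PQ] := totP v; exists c.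
have Q00 : Q (0, 0).
  by have [c /(scQ 0 _ (lexx _))/=] := totQ 0; rewrite scale0r mul0r.
(* The tight constraints at [v] and [- v] force the value of [l v]. *)
have exQ v : exists c, Q (v, c) /\ Q (- v, - c).
  pose S := [set c | Q (v, c)].
  have lbS d : Q (- v, d) -> lbound S (- d).
    move=> Qd c Sc; have /= := addQ _ _ Qd Sc.
    by rewrite addNr => /Q0; lra.
  have [d Qd] := totQ (- v).
  have infS : has_inf S by split; [exact: totQ|exists (- d); exact: lbS].
  pose a := inf S.
  pose Q' := [set p : V * R | exists t, Q (p.1 - t *: v, p.2 - t * a)].
  have QQ' : Q `<=` Q'.
    by move=> [u c] Quc; exists 0; rewrite scale0r mul0r !subr0.
  have Q'Q : Q' `<=` Q.
    apply: maxQ => //; split.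
    - move=> [u c] [w b] [t /= Qt] [s /= Qs]; exists (t + s) => /=.
      have /= := addQ _ _ Qt Qs.
      by rewrite addrACA -opprD -scalerDl [X in (_, X)]addrACA -opprD -mulrDl.
    - move=> r [u c] r0 [t /= Qt]; exists (r * t).
      by have /= := scQ _ _ r0 Qt; rewrite scalerBr mulrBr scalerA mulrA.
    - move=> c [t /=]; rewrite add0r.
      have [t0|t0|->] := ltrgt0P t; last by rewrite scale0r mul0r subr0 oppr0 => /Q0.
      + have t'0 : 0 <= t^-1 by rewrite invr_ge0 ltW.
        move=> /(scQ _ _ t'0)/=.
        rewrite scalerN scalerA mulVf ?gt_eqF// scale1r => /lbS /(lb_le_inf infS.1).
        rewrite -/a mulrBr mulKf ?gt_eqF// opprB lerBlDr lerDl.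
        by rewrite pmulr_rge0// invr_gt0.
      + have t'0 : 0 <= - t^-1 by rewrite oppr_ge0 invr_le0 ltW.
        move=> /(scQ _ _ t'0)/=.
        rewrite scalerN scaleNr opprK scalerA mulVf ?lt_eqF// scale1r.
        move=> /(ge_inf infS.2).
        rewrite -/a mulNr mulrBr mulKf ?lt_eqF// opprB lerDl -mulNr.
        by rewrite pmulr_rge0// oppr_gt0 invr_lt0.
  exists a; split; apply: Q'Q; [exists 1|exists (-1)].
    by rewrite /= scale1r mul1r !subrr.
  by rewrite /= scaleN1r mulN1r [- - v]opprK [- - a]opprK !addNr.
have [l lQ] := choice exQ; exists l.
have le_l v c : Q (v, c) -> l v <= c.
  move=> Qc; have /= := addQ _ _ Qc (lQ v).2.
  by rewrite subrr => /Q0; rewrite subr_ge0.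
split; last by move=> v c /PQ; exact: le_l.
have uniq v c : Q (v, c) -> Q (- v, - c) -> l v = c.
  move=> Qc QNc; apply/eqP; rewrite eq_le le_l//=.
  by have /= := addQ _ _ (lQ v).1 QNc; rewrite subrr => /Q0; rewrite subr_ge0.
have lN v : l (- v) = - l v by have [? ?] := lQ v; apply: uniq; rewrite ?opprK.
have lD u v : l (u + v) = l u + l v.
  apply: uniq; rewrite ?opprD.
    exact: (addQ _ _ (lQ u).1 (lQ v).1).
  exact: (addQ _ _ (lQ u).2 (lQ v).2).
have lZ0 t v : 0 <= t -> l (t *: v) = t * l v.
  move=> t0; apply: uniq; first exact: (scQ _ _ t0 (lQ v).1).
  by have := scQ _ _ t0 (lQ v).2; rewrite /= scalerN mulrN.
move=> t u v; rewrite lD; congr (_ + _).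
have [t0|/ltW t0] := leP 0 t; first exact: lZ0.
have t0' : 0 <= - t by rewrite oppr_ge0.
by rewrite -[t]opprK scaleNr lN lZ0// -mulNr.
Qed.

End HahnBanach.

(** * The dual pairing and the weak* topology *)

(** Naming the evaluation hides the regular-module structure [R^o] carried by
the values of functionals, so that the arithmetic tactics see real numbers. *)
Definition pairing (R : realType) (X : normedModType R) (x : X) (f : dual X) : R :=
  f x.
Arguments pairing {R X} x f : simpl never.

Notation "⟨ x , f ⟩" := (pairing x f).

Section DualPairing.
Context {R : realType} {X : normedModType R}.
Implicit Types (f g : dual X) (x y : X).

Lemma dual_linear f : linear (f : X -> R^o).
Proof. by have /continuous_linearP[] := dual_valP f. Qed.

Lemma pairing_continuous f : continuous (pairing ^~ f).
Proof. by have /continuous_linearP[] := dual_valP f. Qed.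

HB.instance Definition _ f :=
  GRing.isLinear.Build R X R^o _ (dual_val f) (dual_linear f).

Lemma pairing0l f : ⟨0, f⟩ = 0.
Proof. exact: (raddf0 (dual_val f)). Qed.

Lemma pairingDl x y f : ⟨x + y, f⟩ = ⟨x, f⟩ + ⟨y, f⟩.
Proof. exact: (raddfD (dual_val f)). Qed.

Lemma pairingNl x f : ⟨- x, f⟩ = - ⟨x, f⟩.
Proof. exact: (raddfN (dual_val f)). Qed.

Lemma pairingZl t x f : ⟨t *: x, f⟩ = t * ⟨x, f⟩.
Proof. exact: (linearZ_LR (dual_val f)). Qed.

Lemma pairingDr x f g : ⟨x, f + g⟩ = ⟨x, f⟩ + ⟨x, g⟩.
Proof. by []. Qed.

Lemma pairingNr x f : ⟨x, - f⟩ = - ⟨x, f⟩.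
Proof. by []. Qed.

Lemma pairingZr x t f : ⟨x, t *: f⟩ = t * ⟨x, f⟩.
Proof. by []. Qed.

Definition pairingE :=
  (pairing0l, pairingDl, pairingNl, pairingZl, pairingDr, pairingNr, pairingZr).

Lemma pairing_suml I (r : seq I) (F : I -> X) f :
  ⟨\sum_(i <- r) F i, f⟩ = \sum_(i <- r) ⟨F i, f⟩.
Proof. exact: (raddf_sum (dual_val f)). Qed.

Lemma dual_of_bounded (l : X -> R) (M : R) : linear (l : X -> R^o) ->
  (forall x, `|l x| <= M * `|x|) -> exists f, forall x, ⟨x, f⟩ = l x.
Proof.
move=> ll lM.
pose L : {linear X -> R^o} := HB.pack (l : X -> R^o) (GRing.isLinear.Build R X R^o _ l ll).
have cl : continuous (l : X -> R^o).
  apply: (@bounded_linear_continuous _ _ _ L); apply/linear_boundedP.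
  near=> r => x; apply: le_trans (lM x) _.
  apply: ler_wpM2r => //; near: r; exact: nbhs_pinfty_ge.
have lP : (l : X -> R^o) \in @continuous_linear R X by exact/continuous_linearP.
by exists (Dual lP).
Unshelve. all: by end_near. Qed.

Lemma pairing_bounded f : exists2 M, 0 < M & forall x, `|⟨x, f⟩| <= M * `|x|.
Proof.
have : bounded_near (dual_val f) (nbhs (0 : X)).
  apply/linear_bounded_continuous; exact: pairing_continuous.
by move/linear_boundedP => /pinfty_ex_gt0[M M0 fM]; exists M.
Qed.

(** Scaling turns a one-sided bound on a ball into a norm estimate. *)
Lemma le_norm_of_ball_bound (l : X -> R) (r c : R) :
    (forall t x, l (t *: x) = t * l x) -> 0 < r ->
    (forall b, `|b| <= r -> l b <= c) ->
  forall b, l b <= c / r * `|b|.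
Proof.
move=> lZ r0 lc b; have [->|b0] := eqVneq b 0.
  by rewrite -[X in l X](scale0r 0) lZ normr0 mul0r mulr0.
have nb0 : 0 < `|b| by rewrite normr_gt0.
have /lc : `|(r / `|b|) *: b| <= r.
  by rewrite normrZ ger0_norm ?divr_ge0// ?(ltW r0)// divfK// gt_eqF.
rewrite lZ => h; rewrite -(ler_pM2l (divr_gt0 r0 nb0)); apply: le_trans h _.
have -> : r / `|b| * (c / r * `|b|) = c by field; rewrite !gt_eqF.
exact: lexx.
Qed.

(** Continuity is often available only through an upper bound on a ball with
some other centre; linearity moves the ball to the origin. *)
Lemma dual_of_upper_bounded (l : X -> R) (z : X) (r c : R) :
    linear (l : X -> R^o) -> 0 < r ->
    (forall b, `|b| <= r -> l (z + b) <= c) ->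
  exists f, forall x, ⟨x, f⟩ = l x.
Proof.
move=> ll r0 lc.
have lD x y : l (x + y) = l x + l y.
  by have := ll 1 x y; rewrite !scale1r.
have ll0 := lD 0 0; rewrite addr0 in ll0.
have l0 : l 0 = 0 by lra.
have lZ t x : l (t *: x) = t * l x by have := ll t x 0; rewrite !addr0 l0 addr0.
have lN x : l (- x) = - l x by rewrite -scaleN1r lZ mulN1r.
have lM x : l x <= (c - l z) / r * `|x|.
  by apply: le_norm_of_ball_bound => // b /lc; rewrite lD; lra.
apply: (@dual_of_bounded _ ((c - l z) / r)) => // x.
rewrite ler_norml; apply/andP; split; last exact: lM.
by rewrite lerNl -(lN x) -normrN; exact: lM.
Qed.

End DualPairing.

Section WeakStar.
Context {R : realType} {X : normedModType R}.
Implicit Types (f g : dual X) (x y : X).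

Lemma nbhs_pairing f x (e : R) : 0 < e -> \forall g \near f, `|⟨x, g⟩ - ⟨x, f⟩| < e.
Proof.
move=> e0; have /(_ x)/cvgrPdist_lt/(_ e e0) := (dual_cvgP f (nbhs_filter f)).1 (@cvg_id _ _).
move=> h.
by apply: (@filterS _ (nbhs f) _ _ _ _ h) => g; rewrite distrC.
Qed.

(** The basic neighbourhoods form a filter that converges pointwise to [f],
hence converges to [f] in the weak* topology. *)
Lemma nbhs_dualP f (W : set (dual X)) : nbhs f W ->
  exists (s : seq X) (e : R), 0 < e /\
    forall g, (forall x, x \in s -> `|⟨x, g⟩ - ⟨x, f⟩| < e) -> W g.
Proof.
pose F : set_system (dual X) := [set W | exists (s : seq X) (e : R), 0 < e /\
    forall g, (forall x, x \in s -> `|⟨x, g⟩ - ⟨x, f⟩| < e) -> W g].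
have FF : Filter F.
  split.
  - by exists [::], 1.
  - move=> U V [s [e [e0 sU]]] [t [d [d0 tV]]].
    exists (s ++ t), (Num.min e d); split; first by rewrite lt_min e0.
    move=> g gst; split.
      by apply: sU => x xs; have := gst x; rewrite mem_cat xs lt_min => /(_ isT)/andP[].
    by apply: tV => x xs; have := gst x; rewrite mem_cat xs orbT lt_min => /(_ isT)/andP[].
  - by move=> U V UV [s [e [e0 sU]]]; exists s, e; split=> // g /sU/UV.
apply: (dual_cvgP f FF).2 => x; apply/cvgrPdist_lt => e e0.
exists [:: x], e; split=> // g /(_ x); rewrite inE eqxx => /(_ isT).
by rewrite distrC.
Qed.

Lemma closure_pairing_le (D : set (dual X)) x (c : R) :
  (forall f, D f -> ⟨x, f⟩ <= c) -> forall f, closure D f -> ⟨x, f⟩ <= c.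
Proof.
move=> Dc f Df; apply/ler_addgt0Pr => e e0.
have [g [/Dc gc]] := Df _ (nbhs_pairing f x e0).
by rewrite /= ltr_norml => /andP[]; lra.
Qed.

(** Banach-Alaoglu. Along an ultrafilter on the ball each evaluation has values in
a compact segment, hence converges; the pointwise limit is linear and obeys the
same bound. *)
Lemma dual_ball_compact (M : R) :
  compact [set f : dual X | forall x, `|⟨x, f⟩| <= M * `|x|].
Proof.
rewrite compact_ultra => F FU FB.
have cvgF x : exists2 c : R, `|c| <= M * `|x| & ⟨x, g⟩ @[g --> F] --> c.
  pose I := [set` `[- (M * `|x|), M * `|x|]].
  have FI : F (pairing x @^-1` I).
    by apply: filterS FB => g /(_ x) gM; rewrite /preimage /I /= in_itv/= -ler_norml.
  have [c [Ic clc]] := @segment_compact R _ _ (pairing x @ F) _ FI.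
  exists c; first by move: Ic; rewrite /I /= in_itv/= -ler_norml.
  move=> V Vc; have [//|FnV] := in_ultra_setVsetC (pairing x @^-1` V) FU.
  by have [r []] := clc (~` V) V FnV Vc.
pose h x : R := sval (cid2 (cvgF x)).
have hM x : `|h x| <= M * `|x| by rewrite /h; case: cid2.
have hF x : ⟨x, g⟩ @[g --> F] --> h x by rewrite /h; case: cid2.
have [f fh] : exists f, forall x, ⟨x, f⟩ = h x.
  apply: dual_of_bounded hM => t x y.
  apply: (cvg_unique _ (hF (t *: x + y))) => //.
  have -> : pairing (t *: x + y) = (fun g => t * ⟨x, g⟩ + ⟨y, g⟩).
    by apply/funext => g; rewrite !pairingE.
  by apply: cvgD; [apply: cvgMr; exact: hF|exact: hF].
exists f; split=> [x|]; first by rewrite fh.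
by apply/dual_cvgP => x; rewrite -[dual_val f x]/⟨x, f⟩ fh; exact: hF.
Qed.

Lemma closure_prodP (G : set (X * dual X)) x f :
  closure G (x, f) <->
  forall (d : R) W, 0 < d -> nbhs f W ->
    exists a g, [/\ G (a, g), `|a - x| < d & W g].
Proof.
split=> [Gxf d W d0 Wf|H B [[U W] /= [Ux Wf] UWB]].
  have : nbhs (x, f) ([set a | `|a - x| < d] `*` W).
    exists ([set a | `|a - x| < d], W) => //=; split=> //.
    by apply/nbhs_normP; exists d => //= a /=; rewrite distrC.
  by move=> /Gxf[[a g] [Gag [/= ad Wg]]]; exists a, g.
have /nbhs_normP[d d0 dU] := Ux.
have [a [g [Gag ad Wg]]] := H d W d0 Wf.
by exists (a, g); split=> //; apply: UWB; split=> //=; apply: dU; rewrite /= distrC.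
Qed.

End WeakStar.

(** * Interior, monotonicity and normal cones *)

Section Interior.
Context {R : realType} {X : normedModType R}.

Lemma interior_ball (E : set X) x : E° x ->
  exists2 r : R, 0 < r & forall b, `|b| <= r -> E (x + b).
Proof.
move=> /nbhs_normP[r /= r0 rE]; exists (r / 2); first by rewrite divr_gt0.
move=> b br; apply: rE; rewrite /= opprD addrA subrr sub0r normrN.
by apply: le_lt_trans br _; lra.
Qed.

Lemma ball_interior (E : set X) x (r : R) : 0 < r ->
  (forall b, `|b| <= r -> E (x + b)) -> E° x.
Proof.
move=> r0 rE; apply/nbhs_normP; exists r => //= y /ltW; rewrite distrC => /rE.
by rewrite addrC subrK.
Qed.

Lemma closure_norm (E : set X) x : closure E x <->
  forall d : R, 0 < d -> exists2 y, E y & `|y - x| < d.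
Proof.
split=> [Ex d d0|H B /nbhs_normP[d /= d0 dB]].
  have : nbhs x [set y | `|y - x| < d].
    by apply/nbhs_normP; exists d => //= y /=; rewrite distrC.
  by move=> /Ex[y [Ey yd]]; exists y.
by have [y Ey yx] := H d d0; exists y; split => //; apply: dB; rewrite /= distrC.
Qed.

End Interior.

Section Monotone.
Context {R : realType} {X : normedModType R}.
Implicit Types (A : X -> set (dual X)) (f g : dual X) (x y z : X).

Lemma monotone_pairing A x y f g : monotone_operator A -> A x f -> A y g ->
  ⟨x, g⟩ + ⟨y, f⟩ <= ⟨x, f⟩ + ⟨y, g⟩.
Proof.
move=> mA Af Ag; have : 0 <= ⟨x - y, f - g⟩ := mA (x, f) (y, g) Af Ag.
by rewrite !pairingE; lra.
Qed.

(** Otherwise adding (x, f) to the graph would extend A properly. *)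
Lemma maximal_related A x f : maximally_monotone A ->
  (forall y g, A y g -> ⟨x, g⟩ + ⟨y, f⟩ <= ⟨x, f⟩ + ⟨y, g⟩) -> A x f.
Proof.
move=> [mA maxA] rel.
pose B y : set (dual X) := [set g | A y g \/ (y = x /\ g = f)].
suff BA : gra B = gra A.
  by have : gra B (x, f) by [right]; rewrite BA.
apply: maxA; last by move=> [y g]; left.
have self y g : A y g -> 0 <= ⟨x - y, f - g⟩.
  by move=> /rel; rewrite !pairingE; lra.
move=> [y g] [y' g'] Bp Bq; case: (Bp : A y g \/ (y = x /\ g = f)) => [Ag|[-> ->]];
  case: (Bq : A y' g' \/ (y' = x /\ g' = f)) => [Ag'|[-> ->]].
- exact: (mA (y, g) (y', g')).
- change (0 <= ⟨y - x, g - f⟩).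
  by have := self _ _ Ag; rewrite !pairingE; lra.
- exact: self.
- by change (0 <= ⟨x - x, f - f⟩); rewrite subrr pairing0l.
Qed.

Lemma pairing_sumr I (r : seq I) (F : I -> dual X) x :
  ⟨x, \sum_(i <- r) F i⟩ = \sum_(i <- r) ⟨x, F i⟩.
Proof. exact: (big_morph (pairing x)). Qed.

(** If x is the weighted barycentre of points u_i of the domain, with values
f_i, then summing the monotonicity inequalities over all pairs (i, j), with
weights w_i w_j, leaves twice the total weight times the sum in the
conclusion; the cross terms vanish because the vectors w_i (u_i - x) add up
to 0. *)
Lemma monotone_barycenter A x (s : seq (R * (X * dual X))) :
    monotone_operator A ->
    (forall p, p \in s -> 0 <= p.1 /\ A p.2.1 p.2.2) ->
    \sum_(p <- s) p.1 *: (p.2.1 - x) = 0 ->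
  0 <= \sum_(p <- s) p.1 * ⟨p.2.1 - x, p.2.2⟩.
Proof.
move=> mA sA s0.
pose L := \sum_(p <- s) p.1; pose F := \sum_(p <- s) p.1 *: p.2.2.
set S := (X in 0 <= X).
have L0 : 0 <= L.
  by rewrite /L big_seq; apply: sumr_ge0 => p /sA[].
have sum0 h : \sum_(p <- s) p.1 * ⟨p.2.1 - x, h⟩ = 0.
  rewrite -[RHS](pairing0l h) -[in RHS]s0 pairing_suml.
  by apply: eq_bigr => p _; rewrite pairingZl.
(* Monotonicity against the fixed point [q], summed over the other point. *)
have row q : q \in s -> ⟨q.2.1 - x, F⟩ <= S + L * ⟨q.2.1 - x, q.2.2⟩.
  move=> /sA[_ Aq].
  have : 0 <= \sum_(p <- s) p.1 * (⟨p.2.1 - x, p.2.2⟩ + ⟨q.2.1 - x, q.2.2⟩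
                - ⟨q.2.1 - x, p.2.2⟩ - ⟨p.2.1 - x, q.2.2⟩).
    rewrite big_seq; apply: sumr_ge0 => p /sA[p0 Ap]; apply: mulr_ge0 => //.
    by have := monotone_pairing mA Ap Aq; rewrite !pairingE; lra.
  under eq_bigr do rewrite !mulrBr mulrDr.
  rewrite !sumrB big_split/= -mulr_suml sum0 /F pairing_sumr -/S -/L.
  under [in X in _ -> X]eq_bigr do rewrite pairingZr.
  lra.
have : \sum_(q <- s) q.1 * ⟨q.2.1 - x, F⟩ <=
       \sum_(q <- s) q.1 * (S + L * ⟨q.2.1 - x, q.2.2⟩).
  rewrite big_seq [leRHS]big_seq; apply: ler_sum => q qs.
  by apply: ler_wpM2l; [have [] := sA _ qs|exact: row].
have -> : \sum_(q <- s) q.1 * ⟨q.2.1 - x, F⟩ = 0.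
  exact: sum0.
have -> : \sum_(q <- s) q.1 * (S + L * ⟨q.2.1 - x, q.2.2⟩) = 2 * (L * S).
  under eq_bigr do rewrite mulrDr mulrCA.
  by rewrite big_split/= -mulr_suml -mulr_sumr -/L -/S; lra.
have [L00|Lpos] := eqVneq L 0; last first.
  have : 0 < L by rewrite lt_neqAle eq_sym Lpos.
  by move=> Lgt; rewrite pmulr_rge0// pmulr_rge0.
move=> _; rewrite /S big_seq; apply: sumr_ge0 => p ps.
have /eqP : L == 0 by apply/eqP.
rewrite /L big_seq => /eqP; rewrite psumr_eq0; last by move=> q /sA[].
by move=> /allP/(_ p ps); rewrite ps => /eqP ->; rewrite mul0r.
Qed.

(** The defining inequality over the closure of the domain follows from the one
over the domain, by continuity. *)
Lemma normal_coneP A x f : normal_cone (closure (dom A)) x f <->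
  closure (dom A) x /\ forall y g, A y g -> ⟨y - x, f⟩ <= 0.
Proof.
split=> -[cx H]; split=> //.
  move=> y g Ag; rewrite -lee_fin; apply: le_trans H.
  by apply: ereal_sup_ubound; exists y => //; apply: subset_closure; exists g.
apply: ge_ereal_sup => _ [c cc <-]; rewrite lee_fin; change (⟨c - x, f⟩ <= 0).
have [M M0 fM] := pairing_bounded f.
apply/ler_addgt0Pr => e e0.
have /closure_norm/(_ (e / M) (divr_gt0 e0 M0))[y [g Ag] yc] := cc.
have : ⟨c - y, f⟩ <= e.
  apply: le_trans (ler_norm _) (le_trans (fM _) _).
  by rewrite mulrC -ler_pdivlMr// distrC ltW.
by have := H _ _ Ag; rewrite !pairingE; lra.
Qed.

End Monotone.

(** * Growth of a monotone operator around interior points of its domain *)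

Section Growth.
Context {R : realType} {X : completeNormedModType R}.
Variable A : X -> set (dual X).
Hypothesis mA : monotone_operator A.

(** These sets are closed and convex and they cover the domain; they are defined
at all points, also those outside of the domain, which is what lets Baire's
theorem act on them. *)
Let level (n : nat) : set X :=
  [set x | forall y g, A y g -> ⟨x - y, g⟩ <= n%:R * (1 + `|y|)].

Let closed_level n : closed (level n).
Proof.
have -> : level n = \bigcap_(p in gra A)
    [set x | ⟨x, p.2⟩ <= n%:R * (1 + `|p.1|) + ⟨p.1, p.2⟩].
  apply/seteqP; split=> [x xn [y g] /xn|x xn y g Ag]; rewrite /= !pairingE.
    by lra.
  by have := xn (y, g) Ag; rewrite /=; lra.
apply: closed_bigI => p _.
apply: (@closed_comp _ _ (pairing^~ p.2) [set r | r <= _]); last exact: closed_le.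
by move=> x _; exact: pairing_continuous.
Qed.

Let dom_level : dom A `<=` \bigcup_n level n.
Proof.
move=> x [f Af]; have [M M0 fM] := pairing_bounded f.
exists (Num.truncn (M * (1 + `|x|))).+1 => // y g Ag.
set n : R := _%:R; have nM : M * (1 + `|x|) <= n by rewrite /n ltW// truncnS_gt.
have := monotone_pairing mA Af Ag; have := le_trans (ler_norm _) (fM (x - y)).
have h1 : M * `|x - y| <= M * (`|x| + `|y|) by rewrite ler_pM2l// ler_normB.
have h2 : M * (1 + `|x|) * (1 + `|y|) <= n * (1 + `|y|).
  by rewrite ler_wpM2r// addr_ge0.
have h3 : 0 <= M * (1 + `|x| * `|y|) by rewrite mulr_ge0 ?ltW// addr_ge0 ?mulr_ge0.
by move: h2 h3; rewrite !pairingE; lra.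
Qed.

(** Baire's theorem gives a point z close to w that is interior to some level
set. The reflection of z in w is again in the domain, hence in some level set,
and w is the midpoint: a ball around w is half a ball around z plus half that
reflection. *)
Lemma growth_bound w : (dom A)° w -> exists r c : R, [/\ 0 < r, 0 <= c &
  forall y g b, A y g -> `|b| <= r -> ⟨w + b - y, g⟩ <= c * (1 + `|y|)].
Proof.
move=> /interior_ball[rho rho0 rhoA].
pose ball := [set x : X | `|x - w| <= rho].
have [n [z zw zn]] : exists n, exists2 z, ball z & (level n)° z.
  apply: contrapT => noint.
  have cdist : continuous (fun x => `|x - w|).
    move=> x; apply: (@continuous_comp _ _ _ (fun x => x - w)).
      by apply: continuousB; [exact: id|exact: cst_continuous].
    exact: norm_continuous.
  have cball : closed ball.
    by apply: (@closed_comp _ _ (fun x => `|x - w|) [set r | r <= rho]) => [x _|];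
      [exact: cdist|exact: closed_le].
  have /Baire/(_ [set x : X | `|x - w| < rho]) : forall n,
      open (~` (level n `&` ball)) /\ dense (~` (level n `&` ball)).
    move=> n; split; first by apply: closed_openC; exact: closedI.
    move=> O [z Oz] oO; apply: contrapT => nO; apply: noint.
    have OI : O `<=` level n `&` ball.
      by move=> x Ox; apply: contrapT => nx; apply: nO; exists x.
    exists n, z; first by have [] := OI z Oz.
    by apply: (@filterS _ (nbhs z) _ O) => [x /OI[]//|]; exact: open_nbhs_nbhs.
  move=> meets; have [|| x [/= xw xU]] := meets.
  - by exists w; rewrite /= subrr normr0.
  - apply: (@open_comp _ _ (fun x => `|x - w|) [set r | r < rho]).
      by move=> x _; exact: cdist.
    exact: open_lt.
  - have [n _ xn] : (\bigcup_n level n) x.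
      by apply: dom_level; have := rhoA (x - w) (ltW xw); rewrite addrC subrK.
    by apply: (xU n) => //; split=> //; exact: ltW.
have [m _ wm] : (\bigcup_n level n) (w + (w - z)).
  by apply/dom_level/rhoA; rewrite distrC.
have [r r0 rn] := interior_ball zn.
exists (r / 2), ((n%:R + m%:R) / 2); split.
- by rewrite divr_gt0.
- by rewrite divr_ge0 ?addr_ge0.
move=> y g b Ag br.
have /rn/(_ _ _ Ag) : `|2 *: b| <= r by rewrite normrZ ger0_norm//; lra.
by have := wm _ _ Ag; rewrite !pairingE; lra.
Qed.

(** Applying the growth bound at the points [w + b] with b shifted by [y - w]
cancels [y] and leaves a bound on [⟨b, g⟩]. *)
Lemma locally_bounded w : (dom A)° w -> exists r M : R, [/\ 0 < r, 0 <= M &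
  forall y g, A y g -> `|y - w| <= r -> forall b, `|⟨b, g⟩| <= M * `|b|].
Proof.
move=> /growth_bound[r [c [r0 c0 bar]]].
pose C := c * (1 + `|w| + r); exists (r / 2), (C / (r / 2)); split.
- by rewrite divr_gt0.
- by rewrite divr_ge0 ?mulr_ge0// ?addr_ge0//; lra.
move=> y g Ag yw.
have ub b : ⟨b, g⟩ <= C / (r / 2) * `|b|.
  apply: (le_norm_of_ball_bound (l := pairing ^~ g)); [|lra|].
    by move=> t x; exact: pairingZl.
  move=> b' br; have : `|y - w + b'| <= r.
    by apply: le_trans (ler_normD _ _) _; lra.
  move=> /(bar _ _ _ Ag); rewrite addrA subrKC addrAC subrr add0r => h.
  apply: le_trans h _; rewrite /C; apply: ler_wpM2l => //.
  by have := ler_normD w (y - w); rewrite subrKC; lra.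
by move=> b; rewrite ler_norml ub andbT lerNl -pairingNl -normrN ub.
Qed.

End Growth.

(** * The domain of a maximally monotone operator *)

Section Domain.
Context {R : realType} {X : completeNormedModType R}.
Variable A : X -> set (dual X).
Hypothesis maxA : maximally_monotone A.
Let mA : monotone_operator A := proj1 maxA.

(** An element h of A x is a functional with [⟨u - x, h⟩ <= ⟨u - x, f⟩] for all
(u, f) in the graph. These constraints generate a cone that is consistent by
[monotone_barycenter] and total by the absorption hypothesis; local boundedness
at an interior point z makes the resulting functional continuous. *)
Lemma dom_of_absorbing x z : (dom A)° z ->
    (forall v, exists2 s : seq (R * (X * dual X)),
      (forall p, p \in s -> 0 <= p.1 /\ A p.2.1 p.2.2) &
      \sum_(p <- s) p.1 *: (p.2.1 - x) = v) ->
  dom A x.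
Proof.
move=> Dz abs.
pose P : set (X * R) := [set p | exists s : seq (R * (X * dual X)),
  [/\ forall p, p \in s -> 0 <= p.1 /\ A p.2.1 p.2.2,
      \sum_(p <- s) p.1 *: (p.2.1 - x) = p.1 &
      \sum_(p <- s) p.1 * ⟨p.2.1 - x, p.2.2⟩ = p.2]].
have cP : cone_constraints P.
  split.
  - move=> _ _ [s [sA <- <-]] [s' [sA' <- <-]]; exists (s ++ s').
    split; rewrite ?big_cat// => p.
    by rewrite mem_cat => /orP[/sA|/sA'].
  - move=> t _ t0 [s [sA <- <-]].
    exists [seq (t * p.1, p.2) | p <- s]; split.
    + by move=> _ /mapP[p /sA[p0 Ap] ->] /=; split=> //; exact: mulr_ge0.
    + by rewrite big_map scaler_sumr; apply: eq_bigr => p _; rewrite scalerA.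
    + by rewrite big_map mulr_sumr; apply: eq_bigr => p _; rewrite mulrA.
  - by move=> c [s [sA /= s0 <-]]; exact: (monotone_barycenter mA).
have [l [ll lP]] : exists l : X -> R^o, linear l /\ forall v c, P (v, c) -> l v <= c.
  apply: hahn_banach_cone => // v; have [s sA <-] := abs v.
  by eexists; exists s; split.
have lA u f : A u f -> l (u - x) <= ⟨u - x, f⟩.
  move=> Af; apply: lP; exists [:: (1, (u, f))].
  split; rewrite ?big_seq1 ?scale1r ?mul1r// => p.
  by rewrite inE => /eqP ->.
have [r [M [r0 M0 bdd]]] := locally_bounded mA Dz.
have [r' r'0 r'A] := interior_ball Dz.
have [h hl] : exists h, forall y, ⟨y, h⟩ = l y.
  apply: (@dual_of_upper_bounded _ _ _ (z - x) (Num.min r r') (M * (`|z - x| + r))) => //.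
    by rewrite lt_min r0.
  move=> b; rewrite le_min => /andP[br br'].
  have [g Ag] := r'A b br'.
  rewrite addrAC; apply: le_trans (lA _ _ Ag) _; apply: le_trans (ler_norm _) _.
  apply: le_trans (bdd _ _ Ag _ _) _; first by rewrite addrAC subrr add0r.
  by rewrite ler_wpM2l// addrAC; apply: le_trans (ler_normD _ _) _; rewrite lerD2l.
exists h; apply: maximal_related => // y g Ag.
by have := lA _ _ Ag; rewrite -hl !pairingE; lra.
Qed.

(** The point a and a ball around z together absorb around each point between
them, so that these points are in the domain; moving z inside a smaller ball
shows that they are interior. In particular the interior of the domain is
convex, and its closure contains the domain. *)
Lemma dom_segment a z (t : R) : dom A a -> (dom A)° z -> 0 < t -> t <= 1 ->
  (dom A)° (a + t *: (z - a)).
Proof.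
move=> [f Af] Dz t0 t1; have [r r0 rA] := interior_ball Dz.
have seg z' : (exists2 r, 0 < r & forall b, `|b| <= r -> dom A (z' + b)) ->
    dom A (a + t *: (z' - a)).
  move=> [r' r'0 r'A]; apply: (dom_of_absorbing Dz) => v.
  pose s := r' / (1 + `|v|).
  have nv : 0 < 1 + `|v| by rewrite ltr_pwDl.
  have s0 : 0 < s by rewrite divr_gt0.
  have [g Ag] : dom A (z' + s *: v).
    apply: r'A; rewrite normrZ gtr0_norm// /s mulrAC ler_pdivrMr//.
    by rewrite ler_pM2l// lerDr.
  exists [:: ((1 - t) / (t * s), (a, f)); (s^-1, (z' + s *: v, g))].
    move=> p; rewrite !inE => /orP[]/eqP -> /=; split=> //.
      by rewrite divr_ge0 ?mulr_ge0 ?subr_ge0// ltW.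
    by rewrite invr_ge0 ltW.
  rewrite big_cons big_seq1 /=.
  have -> : a - (a + t *: (z' - a)) = (- t) *: (z' - a).
    by rewrite opprD addrA subrr sub0r scaleNr.
  have -> : z' + s *: v - (a + t *: (z' - a)) = (1 - t) *: (z' - a) + s *: v.
    by rewrite scalerBl scale1r opprD addrACA addrA addrAC.
  rewrite [s^-1 *: _]scalerDr !scalerA mulVf ?gt_eqF// scale1r addrA -scalerDl.
  have -> : (1 - t) / (t * s) * - t + s^-1 * (1 - t) = 0 by field; rewrite !gt_eqF.
  by rewrite scale0r add0r.
apply: (@ball_interior _ _ _ _ (t * (r / 2))); first by rewrite mulr_gt0// divr_gt0.
move=> b br.
have -> : a + t *: (z - a) + b = a + t *: (z + t^-1 *: b - a).
  by rewrite [z + _ - a]addrAC [t *: (z - a + _)]scalerDr scalerA mulfV ?gt_eqF// scale1r addrA.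
apply: seg; exists (r / 2); first by rewrite divr_gt0.
move=> b' b'r; rewrite -addrA; apply: rA.
apply: le_trans (ler_normD _ _) _.
have : `|t^-1 *: b| <= r / 2.
  by rewrite normrZ gtr0_norm ?invr_gt0// ler_pdivrMl.
lra.
Qed.

(** The common core of graph closedness (tau = 1) and of the inclusion of the
recession set in the normal cone (tau = 0). Monotonicity survives the limit if
[t * ⟨a - x, g⟩] is eventually at most any given e' > 0. For that, the growth
bound at z is used in the direction [k (a - x)] with k large: it gives
[(k - 1) ⟨a - x, g⟩ <= c (1 + |a|) + ⟨x - z, g⟩], whose right side, times t,
is eventually bounded. *)
Lemma limit_related x f (tau : R) : (dom A)° !=set0 -> 0 <= tau ->
    (forall (d : R) W, 0 < d -> nbhs f W -> exists t a g,
      [/\ 0 <= t, `|t - tau| < d, A a g, `|a - x| < d & W (t *: g)]) ->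
  forall y g, A y g -> ⟨y - x, f⟩ <= tau * ⟨y - x, g⟩.
Proof.
move=> [z Dz] tau0 lim y g Ag; have [r [c [r0 c0 bar]]] := growth_bound mA Dz.
have [M M0 gM] := pairing_bounded g.
apply/ler_addgt0Pr => e e0.
pose e' := e / 4; have e'0 : 0 < e' by rewrite divr_gt0.
pose C := (tau + 1) * (c * (2 + `|x|)) + `|⟨x - z, f⟩| + 1.
have C0 : 0 < C.
  by rewrite ltr_wpDl// addr_ge0// mulr_ge0 ?addr_ge0// mulr_ge0// addr_ge0.
pose k := 1 + C / e'; have k0 : 0 < k by rewrite addr_gt0// divr_gt0.
pose q := `|⟨y - x, g⟩| + 1; have q0 : 0 < q by rewrite ltr_wpDl.
(* [d1] keeps [k (a - x)] in the ball of radius [r] of the growth bound; [d2]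
   and [d3] control the errors due to [a] and to [t]. *)
pose d1 := r / k; have d10 : 0 < d1 by rewrite divr_gt0.
pose d2 := e' / ((tau + 1) * M).
have tau10 : 0 < tau + 1 by rewrite ltr_wpDl.
have d20 : 0 < d2 by rewrite divr_gt0 ?mulr_gt0.
pose d3 := e' / q; have d30 : 0 < d3 by rewrite divr_gt0.
pose d := Num.min (Num.min 1 d1) (Num.min d2 d3).
have d0 : 0 < d by rewrite !lt_min ltr01 d10 d20 d30.
pose W := [set h : dual X | `|⟨x - z, h⟩ - ⟨x - z, f⟩| < 1 /\
  `|⟨y - x, h⟩ - ⟨y - x, f⟩| < e'].
have Wf : nbhs f W by apply: filterI; exact: nbhs_pairing.
have [t [a [b [t0 ttau Ab ax [Wz Wy]]]]] := lim d W d0 Wf.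
move: ttau ax; rewrite !lt_min => /andP[/andP[t1 _] /andP[_ t3]].
move=> /andP[/andP[a1 a2] /andP[a3 _]].
have na : `|a| <= `|x| + 1.
  by have := ler_normD x (a - x); rewrite subrKC; lra.
have t_le : t <= tau + 1 by move: t1; rewrite ltr_norml => /andP[]; lra.
have bound : t * ⟨a - x, b⟩ <= e'.
  have kr : `|k *: (a - x)| <= r.
    by rewrite normrZ gtr0_norm// mulrC -ler_pdivlMr// ltW.
  have h1 : (k - 1) * ⟨a - x, b⟩ <= c * (2 + `|x|) + ⟨x - z, b⟩.
    have h := bar _ _ _ Ab kr.
    have h' : c * (1 + `|a|) <= c * (2 + `|x|) by rewrite ler_wpM2l//; lra.
    by move: h h'; rewrite !pairingE; lra.
  have h2 : (k - 1) * (t * ⟨a - x, b⟩) <= C.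
    rewrite mulrCA; apply: le_trans (ler_wpM2l t0 h1) _.
    rewrite mulrDr -pairingZr /C -[leRHS]addrA; apply: lerD.
      by rewrite ler_wpM2r// mulr_ge0// addr_ge0.
    by have := ler_norm ⟨x - z, f⟩; move: Wz; rewrite ltr_norml => /andP[]; lra.
  move: h2; rewrite /k addrAC subrr add0r mulrAC ler_pdivrMr//.
  by rewrite ler_pM2l.
have mono : ⟨y - x, t *: b⟩ <= t * ⟨a - x, b⟩ + t * ⟨y - x, g⟩ - t * ⟨a - x, g⟩.
  have := monotone_pairing mA Ab Ag.
  rewrite -subr_ge0 => /(mulr_ge0 t0); rewrite !pairingE; lra.
have err1 : t * `|⟨a - x, g⟩| <= e'.
  have h : `|⟨a - x, g⟩| <= e' / (tau + 1).
    apply: le_trans (gM _) _; rewrite mulrC -ler_pdivlMr//.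
    apply: le_trans (ltW a3) _; rewrite /d2 invfM mulrA lexx//.
  apply: le_trans (ler_wpM2l t0 h) _.
  rewrite mulrCA; apply: ler_piMr; first exact: ltW.
  by rewrite ler_pdivrMr// mul1r.
have err2 : (t - tau) * ⟨y - x, g⟩ <= e'.
  apply: le_trans (ler_norm _) _; rewrite normrM.
  apply: (@le_trans _ _ (d3 * q)); last by rewrite divfK ?gt_eqF.
  by apply: ler_pM => //; [exact: ltW|rewrite /q lerDl].
have err1' : - (t * ⟨a - x, g⟩) <= e'.
  apply: le_trans err1; rewrite -mulrN ler_wpM2l//.
  by rewrite -normrN ler_norm.
by move: Wy; rewrite ltr_norml /e' in bound err1' err2 *; move=> /andP[]; lra.
Qed.

End Domain.

(** * Weak* separation *)

Section Separation.
Context {R : realType} {X : normedModType R}.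
Implicit Types (D E : set (dual X)) (f g : dual X).

Definition closed_under_mixtures E := forall g h (t : R), E g -> E h ->
  0 <= t -> t <= 1 -> E (t *: g + (1 - t) *: h).

Lemma convex_setP E : @convex_set R (dual X) E <-> closed_under_mixtures E.
Proof.
split=> [cE g h t Eg Eh t0 t1|cE g h t].
  by have := cE g h (Itv01 t0 t1); rewrite !inE; apply.
by rewrite !inE => Eg Eh; apply: cE.
Qed.

Lemma convex_hull_mixtures D : closed_under_mixtures (convex_hull D).
Proof.
move=> g h t Dg Dh t0 t1 M [cM DM].
by apply: (convex_setP M).1 => //; [apply: Dg|apply: Dh].
Qed.

Let l1norm n (u : 'rV[R]_n) : R := \sum_i `|u 0 i|.

(** A weak* neighbourhood of f that misses E only involves finitely many
points s_i, so the problem takes place in R^n, with the l1 norm. The constraints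
are [l u <= |u|] and [l (T f - T e) <= - d] for e in E; they are consistent
because all points of the convex set T E are at distance at least d from T f. A
linear form on R^n applied to the values at the s_i is evaluation at a
combination of the s_i. *)
Theorem weak_star_separation E f : closed_under_mixtures E -> ~ closure E f ->
  exists v (d : R), 0 < d /\ forall e, E e -> ⟨v, e⟩ + d <= ⟨v, f⟩.
Proof.
move=> cE nEf; have [E0|/set0P[e0 Ee0]] := eqVneq E set0.
  by exists 0, 1; split=> // e; rewrite E0.
have [s [d [d0 far]]] : exists (s : seq X) (d : R), 0 < d /\
    forall e, E e -> exists2 x, x \in s & d <= `|⟨x, e⟩ - ⟨x, f⟩|.
  apply: contrapT => near; apply: nEf => W /nbhs_dualP[s [d [d0 sW]]].
  apply: contrapT => EW; apply: near; exists s, d; split=> // e Ee.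
  apply: contrapT => close; apply: EW; exists e; split=> //; apply: sW => x xs.
  by rewrite ltNge; apply/negP => dx; apply: close; exists x.
pose n := size s.
pose T g : 'rV[R]_n := \row_i ⟨s`_i, g⟩.
have TE g h t : T (t *: g + (1 - t) *: h) - T f =
    t *: (T g - T f) + (1 - t) *: (T h - T f).
  by apply/rowP => i; rewrite !mxE !pairingE; ring.
have N0n : @l1norm n 0 = 0 by rewrite /l1norm big1// => i _; rewrite mxE normr0.
have ND (u v : 'rV[R]_n) : l1norm (u + v) <= l1norm u + l1norm v.
  by rewrite /l1norm -big_split/=; apply: ler_sum => i _; rewrite mxE ler_normD.
have NZ (t : R) (u : 'rV[R]_n) : 0 <= t -> l1norm (t *: u) = t * l1norm u.
  move=> t0; rewrite /l1norm mulr_sumr; apply: eq_bigr => i _.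
  by rewrite mxE normrM ger0_norm.
have Nfar e : E e -> d <= l1norm (T e - T f).
  move=> /far[x xs dx]; have xn : (index x s < n)%N by rewrite index_mem.
  apply: le_trans dx _; rewrite /l1norm (bigD1 (Ordinal xn))//= !mxE nth_index//.
  by rewrite lerDl; apply: sumr_ge0.
pose P : set ('rV[R]_n * R) := [set p | exists (t : R) e,
  [/\ 0 <= t, E e & l1norm (p.1 + t *: (T e - T f)) <= p.2 + t * d]].
have cP : cone_constraints P.
  split.
  - move=> [u c] [u' c'] [t [e [t0 Ee /= H]]] [t' [e' [t'0 Ee' /= H']]].
    exists (t + t').
    have [tt'|tt'] := eqVneq (t + t') 0.
      exists e; split=> //=; first exact: addr_ge0.
      have [t00 t'00] : t = 0 /\ t' = 0 by lra.
      move: H H'; rewrite t00 t'00 addr0 !scale0r !mul0r !addr0.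
      by have := ND u u'; lra.
    have tpos : 0 < t + t' by rewrite lt_neqAle eq_sym tt' addr_ge0.
    exists ((t / (t + t')) *: e + (1 - t / (t + t')) *: e'); split.
    + exact: addr_ge0.
    + apply: cE => //; first by rewrite divr_ge0// ltW.
      by rewrite ler_pdivrMr// mul1r lerDl.
    + rewrite TE scalerDr !scalerA /=.
      have -> : (t + t') * (t / (t + t')) = t by field.
      have -> : (t + t') * (1 - t / (t + t')) = t' by field.
      rewrite addrACA; apply: le_trans (ND _ _) _.
      by move: H H'; lra.
  - move=> r [u c] r0 [t [e [t0 Ee /= H]]]; exists (r * t), e; split=> //=.
      exact: mulr_ge0.
    by rewrite -scalerA -scalerDr NZ// -mulrA -mulrDr ler_wpM2l.
  - move=> c [t [e [t0 Ee /=]]]; rewrite add0r NZ// => H.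
    by have := ler_wpM2l t0 (Nfar _ Ee); lra.
have [|l [ll lP]] := hahn_banach_cone cP.
  by move=> u; exists (l1norm u), 0, e0; split=> //=; rewrite scale0r mul0r !addr0.
pose L : {linear 'rV[R]_n -> R^o} :=
  HB.pack l (GRing.isLinear.Build R 'rV[R]_n R^o _ l ll).
pose v : X := - \sum_i l (delta_mx 0 i) *: s`_i.
have lT g : l (T g) = - ⟨v, g⟩ :> R.
  rewrite pairingNl opprK pairing_suml -[l]/(L : _ -> _) [T g]row_sum_delta linear_sum.
  by apply: eq_bigr => i _; rewrite linearZ mxE pairingZl mulrC.
exists v, d; split=> // e Ee.
have : l (- (T e - T f)) <= - d.
  by apply: lP; exists 1, e; split=> //=; rewrite scale1r addNr N0n mul1r addNr.
have -> : l (- (T e - T f)) = - (l (T e) - l (T f)).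
  by rewrite -[l]/(L : _ -> _) linearN linearB.
by rewrite !lT; lra.
Qed.

End Separation.

(** * The operator A_S *)

Section Cluster.
Context {R : realType} {X : completeNormedModType R}.
Variables (A : X -> set (dual X)) (S : set X).
Hypotheses (maxA : maximally_monotone A).
Hypotheses (SD : S `<=` (dom A)°) (DS : (dom A)° `<=` closure S).
Let mA : monotone_operator A := proj1 maxA.

Lemma graph_closed x f : (dom A)° !=set0 -> closure (gra A) (x, f) -> A x f.
Proof.
move=> D0 /closure_prodP cl; apply: maximal_related => // y g Ag.
suff : ⟨y - x, f⟩ <= 1 * ⟨y - x, g⟩ by rewrite !pairingE; lra.
apply: (limit_related maxA D0) Ag => // d W d0 Wf.
have [a [b [Gab ad Wb]]] := cl d W d0 Wf.
by exists 1, a, b; rewrite subrr normr0 scale1r.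
Qed.

Lemma closure_along_sub x : (dom A)° !=set0 -> closure_along A S x `<=` A x.
Proof.
move=> D0 f cl; apply: graph_closed => //.
by apply: closureS cl => p [].
Qed.

Lemma closure_hull_sub x : (dom A)° !=set0 ->
  closure (convex_hull (closure_along A S x)) `<=` A x.
Proof.
move=> D0.
have AE : A x = [set f | forall y g, A y g -> ⟨y - x, f⟩ <= ⟨y - x, g⟩].
  apply/seteqP; split=> f.
    by move=> Af y g Ag; have := monotone_pairing mA Af Ag; rewrite !pairingE; lra.
  move=> rel; apply: maximal_related => // y g /rel.
  by rewrite !pairingE; lra.
have hullA : convex_hull (closure_along A S x) `<=` A x.
  apply: smallest_sub; last exact: closure_along_sub.
  apply/convex_setP => g h t; rewrite AE => Hg Hh t0 t1 y k Ak.
  have := Hg _ _ Ak; have := Hh _ _ Ak.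
rewrite !(pairingDr, pairingZr).
  by set p := pairing _ _; set q := pairing _ _; set r := pairing _ _; nra.
move=> f clf; rewrite AE => y g Ag.
apply: (closure_pairing_le _ clf) => h /hullA.
by rewrite AE; apply.
Qed.

(** The point y is taken in S at a distance from [x + t v] that is tiny compared
with t and with a local bound of A there, so that the error [e] is harmless
after division by t. The resulting bound on A y is uniform in d, since it comes
from the growth bound at [x + v], where [x + v - y] is about [(1 - t) v] and
[⟨v, g⟩] is bounded from below. *)
Let approach x v f : A x f -> (dom A)° (x + v) ->
  exists M : R, forall d, 0 < d -> exists y g,
    [/\ A y g, S y, `|y - x| < d, ⟨v, f⟩ - d <= ⟨v, g⟩ &
        forall b, `|⟨b, g⟩| <= M * `|b|].
Proof.
move=> Af Dw; have [r [c [r0 c0 bar]]] := growth_bound mA Dw.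
pose C := c * (2 + `|x|) + `|⟨v, f⟩| + 2; exists (C / r) => d' d'0.
pose d := Num.min d' 1.
have d0 : 0 < d by rewrite lt_min d'0 ltr01.
have d1 : d <= 1 by rewrite ge_min lexx orbT.
have dd' : d <= d' by rewrite ge_min lexx.
have nv : 0 < 1 + `|v| by rewrite ltr_pwDl.
pose t := d / 2 / (1 + `|v|).
have t0 : 0 < t by rewrite !divr_gt0.
have tv : t * `|v| <= d / 2.
  by rewrite /t mulrAC ler_pdivrMr// ler_pM2l ?divr_gt0// lerDr.
have t1 : t <= 1.
  rewrite ler_pdivrMr// mul1r; have := normr_ge0 v; lra.
have Dt : (dom A)° (x + t *: v).
  have := dom_segment maxA (ex_intro _ f Af) Dw t0 t1.
  by rewrite [x + v]addrC addrK.
have [r' [M' [r'0 M'0 bdd]]] := locally_bounded mA Dt.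
have [Mf Mf0 fM] := pairing_bounded f.
pose m := Mf + M' + 1; have m0 : 0 < m by rewrite ltr_wpDl// addr_ge0// ltW.
pose eta := Num.min r' (Num.min (d / 2) (t * d / m)).
have eta0 : 0 < eta by rewrite !lt_min r'0 !divr_gt0// mulr_gt0.
have /closure_norm/(_ eta eta0)[y Sy] := DS Dt.
rewrite !lt_min => /andP[yr /andP[yd ym]].
have [g Ag] : dom A y by apply: interior_subset; exact: SD.
have gM := bdd _ _ Ag (ltW yr).
set e := y - (x + t *: v) in yr yd ym.
have yE : y = x + t *: v + e by rewrite /e addrC subrK.
have em : (Mf + M') * `|e| <= t * d.
  apply: (@le_trans _ _ (m * `|e|)); first by rewrite ler_wpM2r// /m lerDl.
  by rewrite mulrC -ler_pdivlMr// ltW.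
have ef := le_trans (ler_norm _) (fM (- e)).
have eg := le_trans (ler_norm _) (gM e); rewrite normrN in ef.
have vg : ⟨v, f⟩ - d <= ⟨v, g⟩.
  rewrite -(ler_pM2l t0).
  have := monotone_pairing mA Af Ag; rewrite yE; move: ef eg em.
  by rewrite !pairingE; lra.
have yx : `|y - x| < d.
  have -> : y - x = t *: v + e.
    by rewrite /e opprD addrCA [t *: v + _]addrC subrK.
  apply: le_lt_trans (ler_normD _ _) _; rewrite normrZ gtr0_norm//; lra.
exists y, g; split=> //; [lra|lra|].
have ub b : ⟨b, g⟩ <= C / r * `|b|.
  apply: (le_norm_of_ball_bound (l := pairing ^~ g)) => //.
    by move=> s z; exact: pairingZl.
  move=> {}b br; have := bar _ _ _ Ag br.
  have na : c * (1 + `|y|) <= c * (2 + `|x|).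
    by rewrite ler_wpM2l//; have := ler_normD x (y - x); rewrite subrKC; lra.
  have eg1 : ⟨e, g⟩ <= 1.
    have : t * d <= 1 by rewrite mulr_ile1// ltW.
    by have : 0 <= Mf * `|e| by [rewrite mulr_ge0// ltW]; lra.
  have vg1 : - ((1 - t) * ⟨v, g⟩) <= `|⟨v, f⟩| + 1.
    have h1 : (1 - t) * (⟨v, f⟩ - d) <= (1 - t) * ⟨v, g⟩ by rewrite ler_wpM2l ?subr_ge0.
    have h2 : (1 - t) * - (`|⟨v, f⟩| + 1) <= (1 - t) * (⟨v, f⟩ - d).
      by rewrite ler_wpM2l ?subr_ge0//; have := ler_norm (- ⟨v, f⟩); rewrite normrN; lra.
    have h3 : 0 <= t * (`|⟨v, f⟩| + 1) by rewrite mulr_ge0 ?addr_ge0// ltW.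
    lra.
  have -> : ⟨x + v + b - y, g⟩ = (1 - t) * ⟨v, g⟩ + ⟨b, g⟩ - ⟨e, g⟩.
    by rewrite /e !pairingE; ring.
  by rewrite /C; lra.
by move=> b; rewrite ler_norml ub andbT lerNl -pairingNl -normrN ub.
Qed.

Lemma closure_along_dominates x v f : A x f -> (dom A)° (x + v) ->
  exists2 k, closure_along A S x k & ⟨v, f⟩ <= ⟨v, k⟩.
Proof.
move=> Af Dw; have [M app] := approach Af Dw.
have inv0 n : 0 < n.+1%:R^-1 :> R by rewrite invr_gt0.
have seq n : exists p : X * dual X, [/\ A p.1 p.2, S p.1, `|p.1 - x| < n.+1%:R^-1,
    ⟨v, f⟩ - n.+1%:R^-1 <= ⟨v, p.2⟩ & forall b, `|⟨b, p.2⟩| <= M * `|b|].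
  by have [y [g H]] := app _ (inv0 n); exists (y, g).
have [p pP] := choice seq.
have [k [_ clk]] : [set g : dual X | forall x, `|⟨x, g⟩| <= M * `|x|]
    `&` cluster ((fun n => (p n).2) @ \oo) !=set0.
  by apply: dual_ball_compact; exists 0%N => // n _; have [_ _ _ _] := pP n.
have often (d : R) W : 0 < d -> nbhs k W -> exists2 n, n.+1%:R^-1 < d & W (p n).2.
  move=> d0 Wk.
  have : ((fun n => (p n).2) @ \oo) [set g | exists2 n, n.+1%:R^-1 < d & g = (p n).2].
    have := near_infty_natSinv_lt (PosNum d0).
    by apply: filterS => n nd; exists n.
  by move=> /clk/(_ Wk)[_ [[n nd ->] Wn]]; exists n.
exists k.
  apply/closure_prodP => d W d0 Wk; have [n nd Wn] := often d W d0 Wk.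
  have [Ap Sp px _ _] := pP n; exists (p n).1, (p n).2.
  by split=> //; exact: lt_trans nd.
apply/ler_addgt0Pr => e e0; have e20 : 0 < e / 2 by rewrite divr_gt0.
have [n nd] := often _ _ e20 (nbhs_pairing k v e20).
rewrite /= ltr_norml => /andP[_]; have [_ _ _ pv _] := pP n.
by move: nd pv; set q := _^-1; lra.
Qed.

End Cluster.

(** * Decomposition of the values of A *)

Section Decomposition.
Context {R : realType} {X : completeNormedModType R}.
Variables (A : X -> set (dual X)) (S : set X).
Hypotheses (maxA : maximally_monotone A) (D0 : (dom A)° !=set0).
Hypotheses (SD : S `<=` (dom A)°) (DS : (dom A)° `<=` closure S).
Let mA : monotone_operator A := proj1 maxA.

Definition inward x v := exists2 t : R, 0 < t & (dom A)° (x + t *: v).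

(** A suitable point on the segment from [x + s u] to [x + t v] is on the ray
from x spanned by [u + v]. *)
Lemma inwardD x u v : inward x u -> inward x v -> inward x (u + v).
Proof.
move=> [s s0 Du] [t t0 Dv]; have st0 : 0 < s + t by rewrite addr_gt0.
exists (s * t / (s + t)); first by rewrite divr_gt0// mulr_gt0.
have -> : x + (s * t / (s + t)) *: (u + v) =
    x + s *: u + (s / (s + t)) *: (x + t *: v - (x + s *: u)).
  rewrite opprD addrACA subrr add0r scalerBr !scalerA scalerDr -[RHS]addrA.
  congr (x + _); rewrite [_ *: v - _]addrC addrA -scalerBl.
  by congr (_ *: u + _ *: v); field; rewrite gt_eqF.
apply: dom_segment => //; first exact: interior_subset.
  by rewrite divr_gt0.
by rewrite ler_pdivrMr// mul1r lerDl ltW.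
Qed.

Lemma inwardZ x (t : R) v : 0 < t -> inward x v -> inward x (t *: v).
Proof.
move=> t0 [s s0 Dv]; exists (s / t); first by rewrite divr_gt0.
by rewrite scalerA divfK// gt_eqF.
Qed.

(** Monotonicity against a point of the domain in the direction v. *)
Lemma closure_along_inward_bounded x v : inward x v ->
  exists c : R, forall k, closure_along A S x k -> ⟨v, k⟩ <= c.
Proof.
move=> [t t0 /interior_subset[g Ag]]; exists ⟨v, g⟩ => k.
move=> /(closure_along_sub maxA D0) Ak.
rewrite -(ler_pM2l t0); have := monotone_pairing mA Ak Ag; rewrite !pairingE; lra.
Qed.

Lemma closure_along_dominates_inward x v f : A x f -> inward x v ->
  exists2 k, closure_along A S x k & ⟨v, f⟩ <= ⟨v, k⟩.
Proof.
move=> Af [t t0 Dv].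
have [k Sk] := closure_along_dominates maxA SD DS Af Dv.
by rewrite !pairingZl ler_pM2l// => vfk; exists k.
Qed.

(** For y in the domain and z in the interior, the points of the segment from y
to z other than y are interior, so their differences with x are inward; let
them tend to y. *)
Lemma dominated_normal x f k : A x f ->
  (forall v, inward x v -> ⟨v, f⟩ <= ⟨v, k⟩) ->
  normal_cone (closure (dom A)) x (f - k).
Proof.
move=> Af fk; apply/normal_coneP; split; first by apply: subset_closure; exists f.
move=> y g Ag; have [z Dz] := D0.
apply/ler_addgt0Pr => e e0; pose q := `|⟨z - y, f - k⟩| + 1.
have q0 : 0 < q by rewrite ltr_wpDl.
pose t := Num.min 1 (e / q).
have t0 : 0 < t by rewrite lt_min ltr01 divr_gt0.
have t1 : t <= 1 by rewrite ge_min lexx.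
have tq : t * q <= e by rewrite -ler_pdivlMr// ge_min lexx orbT.
have /fk : inward x (y + t *: (z - y) - x).
  exists 1 => //; rewrite scale1r addrC subrK.
  by apply: dom_segment => //; exists g.
have tz : - (t * ⟨z - y, f - k⟩) <= e.
  apply: le_trans tq; rewrite -mulrN ler_pM2l// /q.
  by have := ler_norm (- ⟨z - y, f - k⟩); rewrite normrN; lra.
by move: tz; rewrite !pairingE; lra.
Qed.

(** The sandwich argument. The functional k has to satisfy [⟨v, k⟩ <= c]
whenever c bounds A_S(x) in the direction v, and [⟨d, f⟩ <= ⟨d, k⟩] for all
inward d. The cone P consists of the sums of such constraints; its consistency
is the domination of f by A_S(x) on inward vectors. *)
Theorem subgradient_decomposition x f : A x f ->
  exists2 k, closure (convex_hull (closure_along A S x)) k &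
    normal_cone (closure (dom A)) x (f - k).
Proof.
move=> Af; have [z Dz] := D0.
have [r' r'0 r'D] : exists2 r : R, 0 < r & forall b, `|b| <= r -> (dom A)° (z + b).
  by apply: interior_ball; rewrite (interior_id _).1//; exact: open_interior.
pose P : set (X * R) := [set p | exists2 d, d = 0 \/ inward x d &
  forall k, closure_along A S x k -> ⟨p.1 + d, k⟩ <= p.2 + ⟨d, f⟩].
have cP : cone_constraints P.
  split.
  - move=> [u c] [u' c'] [d Cd /= Hd] [d' Cd' /= Hd']; exists (d + d').
      case: Cd Cd' => [->|Cd] [->|Cd']; rewrite ?addr0 ?add0r; [by left|by right..|].
      by right; exact: inwardD.
    by move=> k Sk; have := Hd k Sk; have := Hd' k Sk; rewrite /= !pairingE; lra.
  - move=> t [u c] + [d Cd /= Hd]; rewrite le_eqVlt => /predU1P[<-|t0].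
      exists 0; first by left.
      by move=> k _; rewrite /= scale0r mul0r !addr0 !pairingE.
    exists (t *: d).
      by case: Cd => [->|Cd]; [left; rewrite scaler0|right; exact: inwardZ].
    move=> k Sk; rewrite /= -scalerDr !pairingZl -mulrDr ler_pM2l//.
    exact: Hd.
  - move=> c [d Cd /= Hd].
    have [k Sk dk] : exists2 k, closure_along A S x k & ⟨d, f⟩ <= ⟨d, k⟩.
      case: Cd => [->|Cd]; last exact: closure_along_dominates_inward.
      have xz : inward x (z - x) by exists 1 => //; rewrite scale1r subrKC.
      have [k Sk _] := closure_along_dominates_inward Af xz.
      by exists k => //; rewrite !pairing0l.
    by have := Hd k Sk; rewrite add0r; lra.
have totP u : exists c, P (u, c).
  have nu : 0 < 1 + `|u| by rewrite ltr_pwDl.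
  pose K := (1 + `|u|) / r'; have K0 : 0 < K by rewrite divr_gt0.
  (* A large multiple of [z - x] absorbs the vector [u] into the inward cone. *)
have inK w : `|w| <= 1 + `|u| -> inward x (w + K *: (z - x)).
    move=> wu; exists K^-1; first by rewrite invr_gt0.
    rewrite scalerDr scalerA mulVf ?gt_eqF// scale1r addrCA subrKC addrC.
    apply: r'D; rewrite normrZ gtr0_norm ?invr_gt0// /K invf_div mulrAC.
    by rewrite ler_pdivrMr// ler_pM2l.
  have [|c Hc] := closure_along_inward_bounded (inK u _); first by rewrite lerDr.
  exists (c - ⟨K *: (z - x), f⟩), (K *: (z - x)).
    right; rewrite -[_ *: _]add0r; apply: inK.
    by rewrite normr0 ltW.
  by move=> k /Hc; rewrite /= subrK.
have [l [ll lP]] := hahn_banach_cone cP totP.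
have lf d : inward x d -> l (- d) <= - ⟨d, f⟩.
  move=> Cd; apply: lP; exists d; first by right.
  by move=> k _; rewrite /= !addNr pairing0l.
have [M M0 fM] := pairing_bounded f.
have [k kl] : exists k, forall y, ⟨y, k⟩ = l y.
  apply: (@dual_of_upper_bounded _ _ _ (- (z - x)) r' (M * (r' + `|z - x|))) => //.
  move=> b br.
  have -> : - (z - x) + b = - (z - b - x) by rewrite !opprB -addrA [- z + b]addrC.
  have Cb : inward x (z - b - x).
    by exists 1 => //; rewrite scale1r subrKC; apply: r'D; rewrite normrN.
  apply: le_trans (lf _ Cb) _; rewrite -pairingNl.
  apply: le_trans (ler_norm _) _; apply: le_trans (fM _) _.
  rewrite ler_pM2l// normrN addrAC; apply: le_trans (ler_normB _ _) _.
  by rewrite [leRHS]addrC lerD2l.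
exists k; last first.
  apply: dominated_normal => // v /lf; rewrite -kl pairingNl; lra.
apply: contrapT => /(weak_star_separation (@convex_hull_mixtures _ _ _)).
move=> [v [d [d0 sep]]].
(* Otherwise a separating [v] would give the constraint [⟨v, k⟩ <= ⟨v, k⟩ - d]. *)
have : l v <= ⟨v, k⟩ - d.
  apply: lP; exists 0; first by left.
  move=> h Sh; rewrite /= !addr0 pairing0l addr0.
  have := sep h (@sub_gen_smallest _ _ _ h Sh); lra.
by rewrite -kl; lra.
Qed.

Lemma recession_normal x : recession A x `<=` normal_cone (closure (dom A)) x.
Proof.
move=> f [t [a [b [t0 /cvgrPdist_lt tcvg Aab /cvgrPdist_lt acvg bcvg]]]]; apply/normal_coneP; split.
  apply/closure_norm => d d0.
  have [n _ /(_ n (leqnn n)) nd] := acvg d d0.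
  exists (a n); first by exists (b n); exact: Aab.
  by rewrite distrC.
move=> y g Ag; rewrite -[leRHS](mul0r ⟨y - x, g⟩).
apply: (limit_related maxA D0) Ag => // d W d0 Wf.
have tn := tcvg d d0; have an := acvg d d0.
have bn := bcvg _ Wf.
have [n _ /(_ n (leqnn n)) [[tn' an'] bn']] := filterI (filterI tn an) bn.
exists (t n), (a n), (b n); split.
- exact: ltW.
- by rewrite distrC.
- exact: Aab.
- by rewrite distrC.
- exact: bn'.
Qed.

(** Since A x is stable under adding normal vectors, [f + n h] is in A x;
divided by n it tends to h. *)
Lemma normal_recession x : A x !=set0 ->
  normal_cone (closure (dom A)) x `<=` recession A x.
Proof.
move=> [f Af] h /normal_coneP[_ hN].
exists harmonic, (fun=> x), (fun n => f + n.+1%:R *: h); split.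
- by move=> n; rewrite /harmonic invr_gt0.
- exact: cvg_harmonic.
- move=> n; apply: maximal_related => // y g Ag.
  have := monotone_pairing mA Af Ag.
  have := ler_wpM2l (ler0n R n.+1) (hN _ _ Ag); rewrite mulr0 !pairingE; lra.
- exact: cvg_cst.
apply/dual_cvgP => y.
suff : ⟨y, harmonic n *: (f + n.+1%:R *: h)⟩ @[n --> \oo] --> ⟨y, h⟩ by [].
have -> : (fun n => ⟨y, harmonic n *: (f + n.+1%:R *: h)⟩) =
    (fun n => harmonic n * ⟨y, f⟩ + ⟨y, h⟩).
  by apply/funext => n; rewrite !pairingE mulrDr mulKf.
rewrite -[X in _ --> X]add0r -[X in _ --> X + _](mul0r ⟨y, f⟩).
by apply: cvgD; [apply: cvgMl; exact: cvg_harmonic|exact: cvg_cst].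
Qed.

Lemma normal_translate x f h :
  A x f -> normal_cone (closure (dom A)) x h -> A x (h + f).
Proof.
move=> Af /normal_coneP[_ hN]; apply: maximal_related => // y g Ag.
by have := monotone_pairing mA Af Ag; have := hN _ _ Ag; rewrite !pairingE; lra.
Qed.

End Decomposition.

Theorem theorem4p7 (R : realType) (X : completeNormedModType R)
    (A : X -> set (dual X)) (S : set X) :
  maximally_monotone A ->
  (dom A)° !=set0 ->
  S `<=` (dom A)° ->
  (dom A)° `<=` closure S ->
  forall x : X,
    A x = minkowski_sum (normal_cone (closure (dom A)) x)
                        (closure (convex_hull (closure_along A S x))) /\
    A x = minkowski_sum (recession A x)
                        (closure (convex_hull (closure_along A S x))).
Proof.
move=> maxA D0 SD DS x; split; apply/seteqP; split=> f.
- move=> /(subgradient_decomposition maxA D0 SD DS)[k Kk Nk].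
  by exists (f - k) => //; exists k => //; rewrite subrK.
- move=> [n Nn [k /(closure_hull_sub maxA D0) Ak <-]].
  exact: normal_translate.
- move=> Af; have [k Kk Nk] := subgradient_decomposition maxA D0 SD DS Af.
  exists (f - k); first by apply: normal_recession => //; exists f.
  by exists k => //; rewrite subrK.
- move=> [n /(recession_normal maxA D0) Nn [k /(closure_hull_sub maxA D0) Ak <-]].
  exact: normal_translate.
Qed.
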